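(* Let $(X,d)$ be a (nonempty) compact metric space and let $T:X\to X$ be a continuous map. Let $\dim_B(X)$ denote the upper box dimension of $X$ and $h(X,T)$ the topological entropy of $(X,T)$. Then the aperiodic complexities $\mathcal{F}=\mathcal{F}(X,T)$ and $\mathcal{G}=\mathcal{G}(X,T)$ satisfy $$\mathcal{F}\le \dim_B(X),\qquad \mathcal{G}\le h(X,T).$$
   Context: $\mathbb{N}=\{1,2,\dots\}$, $\mathbb{N}_0=\mathbb{N}\cup\{0\}$. For $l\in\mathbb{N}_0$ the Bowen metric of length $l$ is $d_l(x,y)=\max_{0\le i\le l} d(T^ix,T^iy)$. For $x\in X$ and $\varepsilon>0$ the return time is $s_l(x,\varepsilon)=\inf\{s\in\mathbb{N}: d_l(T^sx,x)<\varepsilon\}\in\mathbb{N}\cup\{\infty\}$, and the shift function of the orbit of $x$ is $$F_x^l(\varepsilon)=\min\{s_l(T^nx,\varepsilon): n\in\mathbb{N}_0\},$$ which is finite by compactness of $X$. Define $$\mathcal{F}_x=\limsup_{\varepsilon\to0}\frac{\log F_x^0(\varepsilon)}{-\log\varepsilon},\qquad \mathcal{G}_x=\lim_{\varepsilon\to0}\limsup_{l\to\infty}\frac{\log F_x^l(\varepsilon)}{l},$$ and $\mathcal{F}(X,T)=\sup_{x\in X}\mathcal{F}_x$, $\mathcal{G}(X,T)=\sup_{x\in X}\mathcal{G}_x$ (the aperiodic complexities). The upper box dimension is $\dim_B(X)=\limsup_{\varepsilon\to0}\frac{\log N(X,\varepsilon)}{-\log\varepsilon}$, where $N(X,\varepsilon)$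 is the maximal cardinality of an $\varepsilon$-separated set in $(X,d)$. The topological entropy is $h(X,T)=\lim_{\varepsilon\to0}\limsup_{l\to\infty}\frac1l\log N_T(l,\varepsilon)$, where $N_T(l,\varepsilon)$ is the maximal cardinality of an $\varepsilon$-separated set in $(X,d_l)$. A set is $\varepsilon$-separated if distinct points have distance at least $\varepsilon$. *)

(* Defs.v *)
From HB Require Import structures.
From mathcomp Require Import all_boot all_order all_algebra finmap.
From mathcomp Require Import all_classical all_reals all_analysis.

Set Implicit Arguments.
Unset Strict Implicit.
Unset Printing Implicit Defensive.

Import Order.TTheory GRing.Theory Num.Theory.
Import numFieldNormedType.Exports.

Local Open Scope classical_set_scope.
Local Open Scope ring_scope.

(* Quantities with values in N u {oo} (return times, shift functions,
   cardinalities) are represented in \bar R, so that their logarithm is [lne].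
   The values of the quotients below at [e >= 1] or [l = 0], where the
   denominator is not positive, do not affect the limits superior. *)

Section DistSeparated.
Context {R : realType} {X : choiceType}.
Implicit Types (d : X -> X -> R) (e : R).

Definition dist_separated d e (A : set X) : Prop :=
  forall x y, A x -> A y -> x <> y -> e <= d x y.

(* The maximal cardinality of an e-separated set, +oo if there are arbitrarily
   large finite ones. *)
Definition separated_number d e : \bar R :=
  ereal_sup [set (#|` A|%:R)%:E | A in
    [set A : {fset X} | dist_separated d e [set` A]]].

End DistSeparated.

Section Dynamics.
Context {R : realType} {X : metricType R}.
Implicit Types (T : X -> X) (l : nat) (e : R) (x y : X).
Local Open Scope ereal_scope.

(* Since distances are nonnegative, the default value 0 of the iterated
   maximum plays no role. *)
Definition bowen T l x y : R :=
  \big[Num.max/0%R]_(i < l.+1) mdist (iter i T x) (iter i T y).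

(* The infimum of the empty set is +oo. *)
Definition return_time T l x e : \bar R :=
  ereal_inf [set s%:R%:E | s in
    [set s : nat | (0 < s)%N /\ (bowen T l (iter s T x) x < e)%R]].

(* The infimum is attained, being over a nonempty subset of N u {oo}. *)
Definition shift_function T l x e : \bar R :=
  ereal_inf [set return_time T l (iter n T x) e | n in [set: nat]].

Definition aperiodicF_at T x : \bar R :=
  limf_esup (fun e : R => lne (shift_function T 0 x e) / (- ln e)%:E)
    (0%R : R)^'+.

(* As e decreases to 0 the inner limit superior increases, so that the outer
   limit exists in \bar R; the same holds for the entropy. *)
Definition aperiodicG_at T x : \bar R :=
  lim (limn_esup (fun l => lne (shift_function T l x e) / l%:R%:E)
    @[e --> (0%R : R)^'+]).

Definition aperiodicF T : \bar R :=
  ereal_sup [set aperiodicF_at T x | x in [set: X]].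

Definition aperiodicG T : \bar R :=
  ereal_sup [set aperiodicG_at T x | x in [set: X]].

Definition topological_entropy T : \bar R :=
  lim (limn_esup (fun l => lne (separated_number (bowen T l) e) / l%:R%:E)
    @[e --> (0%R : R)^'+]).

End Dynamics.

Definition upper_box_dim {R : realType} (X : metricType R) : \bar R :=
  limf_esup (fun e : R =>
      (lne (separated_number (@mdist R X) e) / (- ln e)%:E)%E)
    (0 : R)^'+.

(* Main.v *)
(* Two points of the orbit of x at times i < j are e-close for d_l exactly when
   T^i x returns e-close to itself after j - i steps.  Hence, for every natural
   number k < F_x^l(e), the k + 1 points of the orbit up to time k are
   e-separated for d_l.  So F_x^l(e) is at most the maximal cardinality of an
   e-separated set, and both inequalities follow by monotonicity of the limits
   superior. *)
Require Import Defs.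
From HB Require Import structures.
From mathcomp Require Import all_boot all_order all_algebra.
From mathcomp Require Import finmap.
From mathcomp Require Import all_classical all_reals all_analysis.

Set Implicit Arguments.
Unset Strict Implicit.
Unset Printing Implicit Defensive.

Import Order.TTheory GRing.Theory Num.Theory.
Import numFieldNormedType.Exports.

Local Open Scope classical_set_scope.
Local Open Scope ring_scope.

(** The limit superior is the infimum over V in F of the supremum on V. Each V can be shrunk to its
    intersection with the set where f <= g, which is still in F. *)
Lemma le_limf_esup (R : realType) (I : choiceType) (Y : filteredType I)
    (F : set_system Y) (FF : Filter F) (f g : Y -> \bar R) :
  (\forall y \near F, (f y <= g y)%E) -> (limf_esup f F <= limf_esup g F)%E.
Proof.
move=> fg; rewrite /limf_esup; apply: le_ereal_inf_tmp => _ [V FV <-].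
pose W := V `&` [set y | (f y <= g y)%E].
apply: ereal_inf_le; exists (ereal_sup [set f y | y in W]).
  by exists W => //; exact: filterI.
apply: ge_ereal_sup => _ [y [Vy fgy] <-].
by apply: le_ereal_sup_tmp; exists (g y) => //; exists y.
Qed.

(** [lne] is compared on [0, +oo] only; the nonnegativity lemmas below supply the side condition. *)
Lemma lne_le (R : realType) (a b : \bar R) :
  (0 <= a)%E -> (a <= b)%E -> (lne a <= lne b)%E.
Proof.
move=> a0 ab; rewrite lee_lne// in_itv/= leey andbT//.
exact: le_trans ab.
Qed.

Lemma separated_number_ge0 (R : realType) (X : choiceType)
    (d : X -> X -> R) (e : R) : (0 <= separated_number d e)%E.
Proof. by apply: ereal_sup_ubound; exists fset0. Qed.

Lemma separated_number_anti (R : realType) (X : choiceType)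
    (d : X -> X -> R) (e1 e2 : R) : e1 <= e2 ->
  (separated_number d e2 <= separated_number d e1)%E.
Proof.
move=> e12; apply: ereal_sup_le => _ [A sA <-]; exists A => //.
by move=> x y Ax Ay xy; apply: le_trans e12 _; exact: sA.
Qed.

Section ShiftFunction.
Context {R : realType} {X : metricType R}.
Implicit Types (T : X -> X) (l : nat) (e : R) (x y : X).

Lemma bowen0 T x y : bowen T 0 x y = mdist x y.
Proof. by rewrite /bowen big_ord_recl big_ord0 /= max_l// mdist_ge0. Qed.

Lemma bowen_sym T l x y : bowen T l x y = bowen T l y x.
Proof. by apply: eq_bigr => i _; rewrite metric_sym. Qed.

Lemma bowenxx T l x : bowen T l x x = 0.
Proof.
by rewrite /bowen; elim/big_ind : _ => // [a b -> ->|i _];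
  rewrite ?maxxx ?mdistxx.
Qed.

Lemma return_time_ge0 T l x e : (0 <= return_time T l x e)%E.
Proof. by apply: le_ereal_inf_tmp => _ [s _ <-]; rewrite lee_fin. Qed.

Lemma return_time_anti T l x e1 e2 : e1 <= e2 ->
  (return_time T l x e2 <= return_time T l x e1)%E.
Proof.
move=> e12; apply: ereal_inf_le_tmp => _ [s [s0 se] <-]; exists s => //.
by split => //; exact: lt_le_trans e12.
Qed.

Lemma shift_function_ge0 T l x e : (0 <= shift_function T l x e)%E.
Proof. by apply: le_ereal_inf_tmp => _ [n _ <-]; exact: return_time_ge0. Qed.

Lemma shift_function_anti T l x e1 e2 : e1 <= e2 ->
  (shift_function T l x e2 <= shift_function T l x e1)%E.
Proof.
move=> e12; apply: le_ereal_inf_tmp => _ [n _ <-].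
apply: ereal_inf_le; exists (return_time T l (iter n T x) e2).
  by exists n.
exact: return_time_anti.
Qed.

(** Otherwise j - i > 0 would be an e-return of T^i x, so that the shift function would be at most j
    - i <= k. *)
Lemma orbit_separated T l x e i j k : (i < j <= k)%N ->
  (k%:R%:E < shift_function T l x e)%E ->
  e <= bowen T l (iter j T x) (iter i T x).
Proof.
move=> /andP[ij jk] kF; rewrite leNgt; apply/negP => be.
move: kF; rewrite ltNge => /negP; apply.
apply: (@le_trans _ _ (return_time T l (iter i T x) e)).
  by apply: ereal_inf_lbound; exists i.
apply: (@le_trans _ _ (j - i)%:R%:E).
  apply: ereal_inf_lbound; exists (j - i)%N => //; split.
    by rewrite subn_gt0.
  by rewrite -iterD subnK// ltnW.
by rewrite lee_fin ler_nat (leq_trans (leq_subr _ _)).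
Qed.

Lemma separated_number_gt T l x e k : 0 < e ->
  (k%:R%:E < shift_function T l x e)%E ->
  (k.+1%:R%:E <= separated_number (bowen T l) e)%E.
Proof.
move=> e0 kF.
have sep (i j : 'I_k.+1) : i != j ->
    e <= bowen T l (iter i T x) (iter j T x).
  rewrite -val_eqE neq_ltn => /orP[ij|ji].
    by rewrite bowen_sym (orbit_separated _ kF)// ij -ltnS ltn_ord.
  by rewrite (orbit_separated _ kF)// ji -ltnS ltn_ord.
pose orb (i : 'I_k.+1) := iter i T x.
(* Since e > 0, separation also makes the k + 1 points distinct: a coincidence for i <> j would give
   e <= 0. *)
have inj : injective orb.
  move=> i j; rewrite /orb => ij; apply/eqP; apply: contraPT e0 => /sep.
  by rewrite ij bowenxx => /le_gtF ->.
apply: ereal_sup_ubound; exists [fset orb i | i in 'I_k.+1]%fset => /=.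
  move=> y z /= /imfsetP[i _ ->] /imfsetP[j _ ->] ij; apply: sep.
  by apply: contra_notN ij => /eqP ->.
by rewrite card_imfset//= -cardE card_ord.
Qed.

(** If the separated number were a real r below the shift function, then k = trunc r would also be
    below it, and k + 1 <= r would contradict r < k + 1. *)
Lemma shift_function_le_separated_number T l x e : 0 < e ->
  (shift_function T l x e <= separated_number (bowen T l) e)%E.
Proof.
move=> e0; have := separated_number_ge0 (bowen T l) e.
case sN : (separated_number _ _) => [r| |] //; last by rewrite !leey.
rewrite lee_fin => r0; rewrite leNgt; apply/negP => rF.
have /andP[tr rt] := truncn_itv r0.
have := @separated_number_gt T l x e (Num.trunc r) e0.
rewrite sN lee_fin leNgt rt => /(_ _)/notF; apply.
by apply: le_lt_trans rF; rewrite lee_fin.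
Qed.

End ShiftFunction.

Theorem theorem1p2 (R : realType) (X : metricType R) (T : X -> X)
    (X_neq0 : [set: X] !=set0) (X_compact : compact [set: X])
    (T_cont : continuous T) :
  (aperiodicF T <= upper_box_dim X)%E /\
  (aperiodicG T <= topological_entropy T)%E.
Proof.
(* This includes l = 0, so the quotients can be compared for every l. *)
have invn_ge0 l : (0 <= (l%:R%:E : \bar R)^-1)%E by rewrite inve_ge0 lee_fin.
(* Comparing the outer limits in e requires that both exist. They do because the growth rate is
   monotone in e. *)
have cvg_rate (u : nat -> R -> \bar R) : (forall l e, (0 <= u l e)%E) ->
    (forall l e1 e2, e1 <= e2 -> (u l e2 <= u l e1)%E) ->
    cvg (limn_esup (fun l => lne (u l e) / l%:R%:E)%E @[e --> (0 : R)^'+]).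
  move=> u0 u_anti; apply: nonincreasing_at_right_is_cvge.
  near=> b => e1 e2 _ _ e12; apply: le_limf_esup; apply: nearW => l.
  by apply: lee_wpmul2r => //; apply: lne_le => //; exact: u_anti.
split; apply: ge_ereal_sup => _ [x _ <-].
  apply: le_limf_esup; near=> e.
  have e0 : 0 < e by [].
  (* For e < 1 the denominator - ln e is positive, so dividing by it preserves the inequality. *)
  have e1 : e < 1 by near: e; exact: nbhs_right_lt.
  apply: lee_wpmul2r; first by rewrite inve_ge0 lee_fin oppr_ge0 ln_le0// ltW.
  apply: lne_le; first exact: shift_function_ge0.
  (* The box dimension counts separated sets for d, which is the Bowen metric of length 0. *)
  have -> : @mdist R X = bowen T 0.
    by apply/funext => y; apply/funext => z; rewrite bowen0.
  exact: shift_function_le_separated_number.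
apply: lee_lim.
- apply: (cvg_rate (fun l => shift_function T l x)) => *.
    exact: shift_function_ge0.
  exact: shift_function_anti.
- apply: (cvg_rate (fun l => separated_number (bowen T l))) => *.
    exact: separated_number_ge0.
  exact: separated_number_anti.
near=> e; apply: le_limf_esup; apply: nearW => l; apply: lee_wpmul2r => //.
apply: lne_le; first exact: shift_function_ge0.
exact: shift_function_le_separated_number.
Unshelve. all: by end_near. Qed.
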